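(* Let $L$ be a lattice of finite length. Then $\operatorname{len}(\operatorname{RCSub}(L)) = 1+\operatorname{len}(L)$.
   Context: Sublattices are nonempty by convention. For elements $u,x,v$ of a lattice $L$, let $\mathrm{rc}_L(u,x,v):=\{y\in L : x\wedge y=u \text{ and } x\vee y=v\}$. A sublattice $S$ of $L$ is RC-closed (closed with respect to taking relative complements) if $\mathrm{rc}_L(u,x,v)\subseteq S$ for all $u,x,v\in S$. $\operatorname{RCSub}(L)$ denotes the set consisting of the empty set and all RC-closed sublattices of $L$, ordered by set inclusion $\subseteq$; it is an algebraic lattice. The length $\operatorname{len}(K)$ of a lattice $K$ is the supremum of the lengths of its finite chains, where a finite chain $C$ has length $|C|-1$; $K$ is of finite length if $\operatorname{len}(K)$ is finite. *)

(* Defs.v *)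
From mathcomp Require Import all_boot all_order all_algebra.
From mathcomp Require Import finmap.
From mathcomp Require Import boolp classical_sets constructive_ereal.

Set Implicit Arguments.
Unset Strict Implicit.
Unset Printing Implicit Defensive.

Local Open Scope fset_scope.

Definition chain_in d (T : porderType d) (K : set T) (C : {fset T}) : Prop :=
  (forall x, x \in C -> K x) /\
  (forall x y, x \in C -> y \in C -> (x >=< y)%O).

Definition chain_length d (T : porderType d) (C : {fset T}) : int :=
  (#|` C|%:Z - 1)%R.

(* The length of K for the order that K inherits from T.  Every subset of
   \bar int has a supremum there, so this is the actual supremum, possibly +oo.
   The empty chain has length -1: it is irrelevant when K is nonempty, and
   gives len set0 = -1.  *)
Definition len d (T : porderType d) (K : set T) : \bar int :=
  supremum -oo%E [set (chain_length C)%:E | C in chain_in K]%classic.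

Definition finite_length d (T : porderType d) (K : set T) : Prop :=
  len K \is a fin_num.

Local Open Scope order_scope.

Definition sublattice d (L : latticeType d) (S : set L) : Prop :=
  (exists x, S x) /\
  (forall x y, S x -> S y -> S (x `&` y) /\ S (x `|` y)).

Definition rc d (L : latticeType d) (u x v : L) : set L :=
  [set y | (x `&` y = u)%O /\ (x `|` y = v)%O]%classic.

Definition RC_closed d (L : latticeType d) (S : set L) : Prop :=
  forall u x v, S u -> S x -> S v -> (rc u x v `<=` S)%classic.

(* Taken as a subset of [set L], whose canonical order is inclusion (see
   subsetEset); len (RCSub L) is computed for that order.  *)
Definition RCSub d (L : latticeType d) : set (set L) :=
  [set S | S = set0 \/ (sublattice S /\ RC_closed S)]%classic.

Arguments RCSub {d} L _.

(* Main.v *)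
Require Import Defs.
From mathcomp Require Import all_boot all_order all_algebra.
From mathcomp Require Import finmap.
From mathcomp Require Import boolp classical_sets constructive_ereal.

(** The heart of the matter is that a finite maximal chain of a sublattice T
    generates T by relative complements: if S is RC-closed and contains a
    maximal chain c_0 < ... < c_n of T, then T is included in S
    ([RCSub_maximal_chain]).  Maximality makes c_0 and c_n the bounds of T, so
    one shows by induction on i that S contains every y <= c_i of T.  For
    y <= c_(i+1), the meet of y and c_i is in S by induction; their join lies
    between c_i and c_(i+1), so by maximality it is one of these two, hence
    also in S; and y is a complement of c_i relative to this meet and this
    join.

    Hence, in a strictly increasing chain of RC-closed sublattices, a maximal
    chain of one sublattice is never maximal in the next one, and so extends
    to a larger maximal chain there.  A chain of RC-closed sublattices thus
    yields a chain of L with at least as many elements, and the empty set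
    accounts for one more member of RCSub L ([RCSub_chain_le]).  Conversely, a
    chain of L is copied by its principal ideals, which are RC-closed, and the
    empty set lies below all of them ([RCSub_chain_ideals]). *)

Set Implicit Arguments.
Unset Strict Implicit.
Unset Printing Implicit Defensive.

Import Order.TTheory GRing.Theory Num.Theory.

Local Open Scope fset_scope.
Local Open Scope order_scope.

Lemma supremum_unique d (T : porderType d) (x0 x : T) (A : set T) :
  (A !=set0 -> supremums A x -> supremum x0 A = x)%classic.
Proof.
move=> /set0P/negbTE A0 Ax; rewrite /supremum A0.
by apply: xget_unique => // y /is_subset1_supremums; apply.
Qed.

Section Chains.
Variables (d : Order.disp_t) (T : porderType d).
Implicit Types (K : set T) (C : {fset T}).

Lemma chain_max C : C != fset0 -> {in C &, forall x y, x >=< y} ->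
  exists2 m, m \in C & {in C, forall x, x <= m}.
Proof.
move=> /fset0Pn[x0 x0C] Ccmp.
suff: forall s, {subset s <= C} ->
    exists2 m, m \in C & {in x0 :: s, forall x, x <= m}.
  move=> /(_ (enum_fset C)) [//|m mC mP]; exists m => // x xC.
  by apply: mP; rewrite inE; apply/orP; right.
elim=> [_|y s IHs sC].
  by exists x0 => // x; rewrite inE => /eqP->.
have yC : y \in C by apply: sC; rewrite mem_head.
have [|m mC mP] := IHs; first by move=> x xs; apply: sC; rewrite inE xs orbT.
have [ym|my] := orP (Ccmp _ _ yC mC).
- exists m => // x; rewrite !inE => /or3P[/eqP->|/eqP->//|xs].
    by apply: mP; rewrite mem_head.
  by apply: mP; rewrite inE xs orbT.
- exists y => // x; rewrite !inE => /or3P[/eqP->|/eqP->//|xs].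
    by apply: le_trans my; apply: mP; rewrite mem_head.
  by apply: le_trans my; apply: mP; rewrite inE xs orbT.
Qed.

Definition maximal_chain K C :=
  chain_in K C /\
  forall y, K y -> (forall x, x \in C -> x >=< y) -> y \in C.

Lemma chain_in_fsetU1 K C y : chain_in K C -> K y ->
  (forall x, x \in C -> x >=< y) -> chain_in K (y |` C).
Proof.
move=> [CK Ccmp] Ky Cy; split=> [x|x z]; rewrite !inE.
  by move=> /orP[/eqP->|/CK].
move=> /orP[/eqP->|xC] /orP[/eqP->|zC].
- exact: comparablexx.
- by rewrite comparable_sym Cy.
- exact: Cy.
- exact: Ccmp.
Qed.

(** Adding elements one at a time must stop, since N bounds the cardinal. *)
Lemma chain_extend_maximal K C N :
    (forall C', chain_in K C' -> (#|` C'| <= N)%N) -> chain_in K C ->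
  exists2 C', maximal_chain K C' & C `<=` C'.
Proof.
move=> leN; have [n] := ubnP (N - #|` C|); elim: n C => // n IHn C ltn CK.
case: (pselect (maximal_chain K C)) => [|notmax].
  by exists C => //; apply: fsubset_refl.
have [y [Ky Cy yNC]] : exists y,
    [/\ K y, forall x, x \in C -> x >=< y & y \notin C].
  apply: contrapT => noy; apply: notmax; split=> // y Ky Cy.
  by apply: contrapT => /negP yNC; apply: noy; exists y.
have CyK := chain_in_fsetU1 CK Ky Cy.
have [|C' C'max CyC'] := IHn _ _ CyK.
  have := leN _ CyK; rewrite cardfsU1 yNC add1n => ltC.
  by rewrite subnS -ltnS prednK // subn_gt0.
by exists C' => //; apply: fsubset_trans CyC'; apply: fsubsetU1.
Qed.

Lemma len_max K C : chain_in K C ->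
    (forall C', chain_in K C' -> (#|` C'| <= #|` C|)%N) ->
  len K = ((#|` C|%:Z - 1)%R)%:E.
Proof.
move=> CK Cmax; apply: supremum_unique; first exists (chain_length C)%:E.
  by exists C.
split=> [_ [C' /Cmax leC' <-]|y]; last by apply; exists C.
by rewrite lee_fin lerB// lez_nat.
Qed.

(** If cardinals of chains were unbounded, the only upper bound of their
    lengths would be +oo, contradicting finiteness; a bounded nonempty set of
    natural numbers has a greatest element. *)
Lemma finite_length_max_chain K : finite_length K ->
  exists2 C, chain_in K C &
    forall C', chain_in K C' -> (#|` C'| <= #|` C|)%N.
Proof.
move=> finK.
have [N leN] : exists N, forall C, chain_in K C -> (#|` C| <= N)%N.
  apply: contrapT => unb; move: finK; rewrite /finite_length.
  suff -> : len K = +oo%E by [].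
  apply: supremum_unique.
    by exists (chain_length (fset0 : {fset T}))%:E; exists fset0.
  split=> [? _|y yub]; first exact: leey.
  (* An integer bound y on the lengths would bound the cardinals by |y| + 1,
     and a bound -oo would mean that there is no chain at all. *)
  case: y yub => [y|//|] yub; exfalso; apply: unb.
    exists (`|y|.+1)%N => C CK; have := yub _ (ex_intro2 _ _ C CK erefl).
    rewrite lee_fin /chain_length lerBlDr => /le_trans leC.
    rewrite -lez_nat; apply: leC.
    by rewrite -addn1 PoszD lerD2r abszE ler_norm.
  by exists 0%N => C CK; have := yub _ (ex_intro2 _ _ C CK erefl).
pose P n := `[< exists2 C, chain_in K C & #|` C| = n >].
have exP : exists n, P n.
  by exists 0%N; apply/asboolP; exists fset0; rewrite ?cardfs0//; split.
have ubP n : P n -> (n <= N)%N by move=> /asboolP[C /leN leC <-].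
have [n /asboolP[C CK <-] Cmax] := ex_maxnP exP ubP.
by exists C => // C' C'K; apply: Cmax; apply/asboolP; exists C'.
Qed.

End Chains.

Section RelativeComplements.
Variables (d : Order.disp_t) (L : latticeType d).
Implicit Types (S T : set L) (C : {fset L}).

Lemma RCSub_meet_join S x y : RCSub L S -> S x -> S y ->
  S (x `&` y) /\ S (x `|` y).
Proof. by move=> [->//|[[_ SL] _]] Sx Sy; apply: SL. Qed.

Lemma RCSub_rc S x y : RCSub L S -> S x -> S (x `&` y) -> S (x `|` y) -> S y.
Proof. by move=> [->//|[_ SRC]] Sx Su Sv; apply: (SRC _ _ _ Su Sx Sv). Qed.

(** The induction on the position of c in the chain is an induction on the
    number of elements of C below c, and the predecessor b of c is the
    greatest of these elements. *)
Lemma RCSub_maximal_chain S T C : RCSub L S -> RCSub L T ->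
  maximal_chain T C -> (forall x, x \in C -> S x) -> (T `<=` S)%classic.
Proof.
move=> RS RT [[CT Ccmp] Cmax] CS.
have below c : c \in C -> forall y, T y -> y <= c -> S y.
  have [n] := ubnP #|` [fset x in C | x < c]|.
  elim: n c => // n IHn c ltn cC y Ty yc.
  have [C0|[x xC]] := fset_0Vmem [fset x in C | x < c].
    (* c is the least element of C, so y is comparable with all of C. *)
    apply/CS/Cmax => // x xC.
    have cx : c <= x.
      have := in_fset0 x; rewrite -C0 !inE xC /=.
      have [xc|//] := orP (Ccmp _ _ xC cC).
      by rewrite lt_neqAle xc andbT => /negbFE/eqP->.
    by rewrite /Order.comparable (le_trans yc cx) orbT.
  have [|u v|b] := @chain_max _ _ [fset x in C | x < c].
  - by apply/fset0Pn; exists x.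
  - by rewrite !inE => /andP[uC _] /andP[vC _]; apply: Ccmp.
  rewrite !inE => /andP[bC bc] bmax.
  have [Tyb Tjb] := RCSub_meet_join RT (CT _ bC) Ty.
  apply: (RCSub_rc RS (CS _ bC)).
    apply: (IHn b) => //; last exact: leIl.
    apply: leq_trans (fproper_ltn_card _) ltn.
    rewrite fproperE; apply/andP; split.
      by apply/fsubsetP => z; rewrite !inE => /andP[-> /lt_trans->].
    by apply/fsubsetPn; exists b; rewrite !inE ?bC ?bc ?ltxx.
  (* b <= b `|` y <= c, and no element of C is strictly between b and c. *)
  apply/CS/Cmax => // x' x'C.
  have [cx|xc] := orP (Ccmp _ _ cC x'C).
    rewrite /Order.comparable leUx (le_trans (ltW bc) cx).
    by rewrite (le_trans yc cx) orbT.
  have := xc; rewrite le_eqVlt => /predU1P[->|ltxc].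
    by rewrite /Order.comparable leUx (ltW bc) yc orbT.
  rewrite /Order.comparable (le_trans (bmax x' _) (leUl _ _))//.
  by rewrite !inE x'C ltxc.
(* The greatest element m of C bounds T: m `|` y is comparable with all of C,
   hence in C, hence at most m. *)
move=> y Ty.
have [C0|[x xC]] := fset_0Vmem C.
  by have := in_fset0 y; rewrite -C0 Cmax// => x; rewrite C0.
have C0 : C != fset0 by apply/fset0Pn; exists x.
have [m mC mmax] := chain_max C0 Ccmp.
apply: (below m) => //.
have [_ Tmy] := RCSub_meet_join RT (CT _ mC) Ty.
apply: le_trans (leUr _ m) (mmax _ _); apply: Cmax => // z zC.
by rewrite /Order.comparable (le_trans (mmax _ zC) (leUl _ _)).
Qed.

(** Induction on K, by removing its greatest member S: a maximal chain of the
    next member S' is not maximal in S, since otherwise S would be included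
    in S'.  The successor accounts for the empty set, which may belong to K
    and whose maximal chain is empty. *)
Lemma RCSub_chain_le (K : {fset set L}) N :
    (forall C, chain_in [set: L]%classic C -> (#|` C| <= N)%N) ->
    chain_in (RCSub L) K -> (#|` K| <= N.+1)%N.
Proof.
move=> leN [KR Kcmp].
have leNT T C : chain_in T C -> (#|` C| <= N)%N.
  by move=> [_ Ccmp]; apply: leN; split.
have [->|K0] := eqVneq K fset0; first by rewrite cardfs0.
suff: exists S C, [/\ S \in K, maximal_chain S C &
    (#|` K| <= #|` C|.+1)%N].
  by move=> [S [C [_ [/leNT leC _] leK]]]; apply: leq_trans leK _.
have [n] := ubnP #|` K|; elim: n K K0 KR Kcmp => // n IHn K K0 KR Kcmp ltn.
have [S SK Smax] := chain_max K0 Kcmp.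
have cardK : #|` K| = #|` K `\ S|.+1 by rewrite (cardfsD1 S) SK.
exists S.
have [K'0|K'0] := eqVneq (K `\ S) fset0.
  have [|C Cmax _] := @chain_extend_maximal _ _ S fset0 N (@leNT S).
    by split.
  by exists C; split=> //; rewrite cardK K'0 cardfs0.
have [| | |S' [C' [S'K [C'S' C'max] leC']]] := IHn (K `\ S) K'0.
- by move=> x; rewrite !inE => /andP[_ /KR].
- by move=> x y; rewrite !inE => /andP[_ xK] /andP[_ yK]; apply: Kcmp.
- by rewrite -ltnS -cardK.
move: S'K; rewrite !inE => /andP[S'S S'K].
have S'leS : (S' `<=` S)%classic by rewrite -subsetEset; apply: Smax.
have [|C Cmax C'C] := @chain_extend_maximal _ _ S C' N (@leNT S).
  by case: C'S' => C'S' ?; split=> // x /C'S'/S'leS.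
exists C; split=> //; rewrite cardK ltnS; apply: leq_trans leC' _.
apply: fproper_ltn_card; rewrite fproperEneq C'C andbT.
apply: contraNneq S'S => CC'; apply/eqP/seteqP; split=> //.
apply: (RCSub_maximal_chain (KR _ S'K) (KR _ SK) Cmax) => x.
by rewrite -CC'; apply: C'S'.1.
Qed.

Definition principal_ideal (a : L) : set L := [set x | x <= a]%classic.

Lemma principal_ideal_inj : injective principal_ideal.
Proof.
move=> a b ab; apply/eqP; rewrite eq_le.
have: principal_ideal a a by rewrite /principal_ideal /=.
have: principal_ideal b b by rewrite /principal_ideal /=.
by rewrite {1}ab -{1}ab /principal_ideal /= => -> ->.
Qed.

(** A relative complement y of x satisfies y <= v where v is the join, so that
    every sublattice which is a down-set is RC-closed. *)
Lemma RCSub_principal_ideal a : RCSub L (principal_ideal a).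
Proof.
right; split; first split.
- by exists a; rewrite /principal_ideal /=.
- rewrite /principal_ideal => x y /= xa ya.
  by split; [apply: le_trans xa; apply: leIl|rewrite leUx xa].
- rewrite /principal_ideal => u x v /= _ _ va y /= [_ xyv].
  by apply: le_trans va; rewrite -xyv leUr.
Qed.

(** Principal ideals are used rather than the intervals from a least element,
    so that the empty lattice is covered as well. *)
Lemma RCSub_chain_ideals C : chain_in [set: L]%classic C ->
  exists2 K, chain_in (RCSub L) K & #|` K| = #|` C|.+1.
Proof.
move=> [_ Ccmp]; pose I := [fset principal_ideal a | a in C]%fset.
exists ((set0 : set L) |` I).
  apply: chain_in_fsetU1; last 2 first.
  - by left.
  - by move=> x _; apply/orP; right; rewrite subsetEset; apply: sub0set.
  split=> [_ /imfsetP[a _ ->]|_ _ /imfsetP[a /= aC ->] /imfsetP[b /= bC ->]].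
    exact: RCSub_principal_ideal.
  have [ab|ba] := orP (Ccmp _ _ aC bC); apply/orP; [left|right];
    by rewrite subsetEset => x /= /le_trans; apply.
rewrite cardfsU1 card_imfset /=; last exact: principal_ideal_inj.
case: imfsetP => // -[a _ a0].
by have: principal_ideal a a := lexx a; rewrite -a0.
Qed.

End RelativeComplements.

Theorem theorem1 (d : Order.disp_t) (L : latticeType d)
    (hL : finite_length [set: L]%classic) :
  len (RCSub L) = (1 + len [set: L]%classic)%E.
Proof.
have [C CL Cmax] := finite_length_max_chain hL.
have [K KR cardK] := RCSub_chain_ideals CL.
rewrite (len_max CL Cmax) (len_max KR); last first.
  by move=> K' K'R; rewrite cardK; apply: RCSub_chain_le K'R.
by rewrite cardK -EFinD -add1n PoszD addrA.
Qed.
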